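(* Let $Q$ be a restriction quantal frame with identity $e$. Then the maps $A\mapsto A\cap e^{\downarrow}$ and $F\mapsto F^{\uparrow}=\{x\in Q:\exists f\in F,\ f\le x\}$ are mutually inverse order isomorphisms (with respect to inclusion) between the set of identity completely prime filters of $Q$ and the set of completely prime filters of the frame $e^{\downarrow}=\{x\in Q:x\le e\}$.
   Context: A restriction quantal frame is a frame $(Q,\le)$ with associative multiplication distributing over arbitrary joins on both sides, which is a monoid with identity $e$ and carries join-preserving unary operations $a\mapsto a^{\ast}$, $a\mapsto a^{+}$ with values in the set $e^{\downarrow}$ of projections (a commutative subsemigroup of idempotents), fixing projections, with $aa^{\ast}=a$, $a^{+}a=a$, $(ab)^{\ast}=(a^{\ast}b)^{\ast}$, $(ab)^{+}=(ab^{+})^{+}$; the top element is a join of partial isometries ($a$ with $b\le a\Rightarrow b=b^{+}a=ab^{\ast}$) and partial isometries are closed under product. A completely prime filter in a frame (or in $Q$) is a nonempty, upward closed subset closed under binary meets, not containing $0$, such that if $\bigvee_{i\in I}a_i$ belongs to it then some $a_i$ belongs to it. An identity completely prime filter of $Q$ is a completely prime filter of $Q$ containing at least one projection. *)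

(* Defs.v *)
(* Subsets of a carrier are represented as predicates [car -> Prop]. *)

Record RQF := {
  car :> Type;
  le : car -> car -> Prop;
  sup : (car -> Prop) -> car;
  meet : car -> car -> car;
  mul : car -> car -> car;
  e : car;
  star : car -> car;
  plus : car -> car;

  le_refl : forall a, le a a;
  le_trans : forall a b c, le a b -> le b c -> le a c;
  le_antisym : forall a b, le a b -> le b a -> a = b;
  sup_ub : forall (S : car -> Prop) s, S s -> le s (sup S);
  sup_least : forall (S : car -> Prop) u, (forall s, S s -> le s u) -> le (sup S) u;
  meet_lb1 : forall a b, le (meet a b) a;
  meet_lb2 : forall a b, le (meet a b) b;
  meet_greatest : forall a b c, le c a -> le c b -> le c (meet a b);
  meet_sup : forall a (S : car -> Prop),
      meet a (sup S) = sup (fun y => exists s, S s /\ y = meet a s);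
  mul_assoc : forall a b c, mul a (mul b c) = mul (mul a b) c;
  mul_sup_l : forall (S : car -> Prop) b,
      mul (sup S) b = sup (fun y => exists s, S s /\ y = mul s b);
  mul_sup_r : forall a (S : car -> Prop),
      mul a (sup S) = sup (fun y => exists s, S s /\ y = mul a s);
  mul_e_l : forall a, mul e a = a;
  mul_e_r : forall a, mul a e = a;
  proj_idem : forall p, le p e -> mul p p = p;
  proj_comm : forall p q, le p e -> le q e -> mul p q = mul q p;
  star_sup : forall (S : car -> Prop),
      star (sup S) = sup (fun y => exists s, S s /\ y = star s);
  plus_sup : forall (S : car -> Prop),
      plus (sup S) = sup (fun y => exists s, S s /\ y = plus s);
  star_proj : forall a, le (star a) e;
  plus_proj : forall a, le (plus a) e;
  star_fix : forall p, le p e -> star p = p;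
  plus_fix : forall p, le p e -> plus p = p;
  mul_star : forall a, mul a (star a) = a;
  plus_mul : forall a, mul (plus a) a = a;
  star_mul : forall a b, star (mul a b) = star (mul (star a) b);
  plus_mul2 : forall a b, plus (mul a b) = plus (mul a (plus b));
  (* top is a join of partial isometries *)
  top_pi : sup (fun _ => True) =
           sup (fun a => forall b, le b a -> b = mul (plus b) a /\ b = mul a (star b));
  (* partial isometries closed under product *)
  pi_mul : forall a c,
      (forall b, le b a -> b = mul (plus b) a /\ b = mul a (star b)) ->
      (forall b, le b c -> b = mul (plus b) c /\ b = mul c (star b)) ->
      (forall b, le b (mul a c) -> b = mul (plus b) (mul a c) /\ b = mul (mul a c) (star b))
}.

Arguments le {r} _ _.
Arguments sup {r} _.
Arguments meet {r} _ _.
Arguments mul {r} _ _.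
Arguments e {r}.

Definition bot {Q : RQF} : Q := sup (fun _ => False).

Definition cpf (Q : RQF) (A : Q -> Prop) : Prop :=
  (exists a, A a) /\
  (forall a b, A a -> le a b -> A b) /\
  (forall a b, A a -> A b -> A (meet a b)) /\
  ~ A bot /\
  (forall S : Q -> Prop, A (sup S) -> exists s, S s /\ A s).

Definition icpf (Q : RQF) (A : Q -> Prop) : Prop :=
  cpf Q A /\ exists p, A p /\ le p e.

(* completely prime filter of the frame e^down = {x | x <= e}, given as a subset
   F of Q contained in e^down.  Meets, joins and the bottom of e^down coincide
   with those computed in Q (e^down is a down-set). *)
Definition cpf_down (Q : RQF) (F : Q -> Prop) : Prop :=
  (forall x, F x -> le x e) /\
  (exists a, F a) /\
  (forall a b, F a -> le a b -> le b e -> F b) /\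
  (forall a b, F a -> F b -> F (meet a b)) /\
  ~ F bot /\
  (forall S : Q -> Prop, (forall s, S s -> le s e) -> F (sup S) -> exists s, S s /\ F s).

Definition restr (Q : RQF) (A : Q -> Prop) : Q -> Prop :=
  fun x => A x /\ le x e.

Definition upcl (Q : RQF) (F : Q -> Prop) : Q -> Prop :=
  fun x => exists f, F f /\ le f x.

Definition subset {T : Type} (A B : T -> Prop) : Prop := forall x, A x -> B x.
Definition seteq {T : Type} (A B : T -> Prop) : Prop := forall x, A x <-> B x.

(* Main.v *)
Require Import Defs.

(* Restricting an identity completely prime filter
     A to e↓ gives a completely prime filter of e↓; conversely the up-closure
     F↑ of a completely prime filter F of e↓ is a completely prime filter of Q
     (complete primeness via distributivity), containing projections.  The two
     constructions are inverse to each other: (A ∩ e↓)↑ = A because A contains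
     a projection p and x ∈ A gives x ∧ p ∈ A ∩ e↓; F↑ ∩ e↓ = F because F is
     up-closed inside e↓.
   - Order: both maps are monotone for inclusion, and a monotone map with a
     monotone left inverse reflects inclusion, so both are order isomorphisms. *)

Lemma bot_le (Q : RQF) (x : Q) : le bot x.
Proof. apply sup_least. intros s []. Qed.

Lemma meet_of_le (Q : RQF) (f x : Q) : le f x -> meet f x = f.
Proof.
  intro fx. apply le_antisym.
  - apply meet_lb1.
  - apply meet_greatest; [apply le_refl | exact fx].
Qed.

(* An element below a join is the join of its meets with the joinands;
   this is what makes the up-closure of a completely prime filter prime. *)
Lemma le_sup_meet_decomp (Q : RQF) (f : Q) (S : Q -> Prop) :
  le f (sup S) -> f = sup (fun y => exists s, S s /\ y = meet f s).
Proof. intro fS. rewrite <- meet_sup. symmetry. apply meet_of_le, fS. Qed.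

Lemma restr_cpf_down (Q : RQF) (A : Q -> Prop) :
  icpf Q A -> cpf_down Q (restr Q A).
Proof.
  intros [[_ [A_up [A_meet [A_bot A_prime]]]] [p [Ap pe]]]. unfold restr.
  split; [intros x [_ xe]; exact xe |].
  split; [exists p; split; assumption |].
  split; [intros a b [Aa _] ab be; split; [exact (A_up a b Aa ab) | exact be] |].
  split.
  { intros a b [Aa ae] [Ab _]. split.
    - apply A_meet; assumption.
    - apply le_trans with a; [apply meet_lb1 | exact ae]. }
  split; [intros [Abot _]; exact (A_bot Abot) |].
  intros S S_proj [AS _]. destruct (A_prime S AS) as [s [Ss As]].
  exists s. split; [exact Ss | split; [exact As | exact (S_proj s Ss)]].
Qed.

Lemma upcl_icpf (Q : RQF) (F : Q -> Prop) :
  cpf_down Q F -> icpf Q (upcl Q F).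
Proof.
  intros [F_proj [[a Fa] [F_up [F_meet [F_bot F_prime]]]]]. unfold upcl.
  split; [split | exists a; split; [exists a; split; [exact Fa | apply le_refl] | exact (F_proj a Fa)]].
  { exists a, a. split; [exact Fa | apply le_refl]. }
  split.
  { intros x y [f [Ff fx]] xy. exists f. split; [exact Ff | apply le_trans with x; assumption]. }
  split.
  { intros x y [f [Ff fx]] [g [Fg gy]]. exists (meet f g). split.
    - apply F_meet; assumption.
    - apply meet_greatest.
      + apply le_trans with f; [apply meet_lb1 | exact fx].
      + apply le_trans with g; [apply meet_lb2 | exact gy]. }
  split.
  { intros [f [Ff fbot]]. apply F_bot.
    replace bot with f; [exact Ff | apply le_antisym; [exact fbot | apply bot_le]]. }
  intros S [f [Ff fS]].
  pose proof (F_proj f Ff) as fe.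
  rewrite (le_sup_meet_decomp Q f S fS) in Ff.
  assert (meets_proj : forall y, (exists s, S s /\ y = meet f s) -> le y e).
  { intros y [s [_ ->]]. apply le_trans with f; [apply meet_lb1 | exact fe]. }
  destruct (F_prime _ meets_proj Ff) as [y [[s [Ss ->]] Fy]].
  exists s. split; [exact Ss |]. exists (meet f s). split; [exact Fy | apply meet_lb2].
Qed.

(* (A ∩ e↓)↑ = A: the projection p ∈ A gives x ∧ p ∈ A ∩ e↓ below each x ∈ A. *)
Lemma upcl_restr (Q : RQF) (A : Q -> Prop) :
  icpf Q A -> seteq (upcl Q (restr Q A)) A.
Proof.
  intros [[_ [A_up [A_meet _]]] [p [Ap pe]]] x. unfold upcl, restr. split.
  - intros [f [[Af _] fx]]. exact (A_up f x Af fx).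
  - intros Ax. exists (meet x p). split.
    + split; [apply A_meet; assumption | apply le_trans with p; [apply meet_lb2 | exact pe]].
    + apply meet_lb1.
Qed.

Lemma restr_upcl (Q : RQF) (F : Q -> Prop) :
  cpf_down Q F -> seteq (restr Q (upcl Q F)) F.
Proof.
  intros [F_proj [_ [F_up _]]] x. unfold upcl, restr. split.
  - intros [[f [Ff fx]] xe]. exact (F_up f x Ff fx xe).
  - intros Fx. split; [exists x; split; [exact Fx | apply le_refl] | exact (F_proj x Fx)].
Qed.

Lemma restr_mono (Q : RQF) (A B : Q -> Prop) :
  subset A B -> subset (restr Q A) (restr Q B).
Proof. intros AB x [Ax xe]. split; [exact (AB x Ax) | exact xe]. Qed.

Lemma upcl_mono (Q : RQF) (F G : Q -> Prop) :
  subset F G -> subset (upcl Q F) (upcl Q G).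
Proof. intros FG x [f [Ff fx]]. exists f. split; [exact (FG f Ff) | exact fx]. Qed.

Lemma subset_iff_of_retraction {T U : Type}
    (phi : (T -> Prop) -> U -> Prop) (psi : (U -> Prop) -> T -> Prop)
    (A B : T -> Prop) :
  (forall X Y, subset X Y -> subset (phi X) (phi Y)) ->
  (forall X Y, subset X Y -> subset (psi X) (psi Y)) ->
  seteq (psi (phi A)) A -> seteq (psi (phi B)) B ->
  (subset A B <-> subset (phi A) (phi B)).
Proof.
  intros phi_mono psi_mono retA retB. split.
  - apply phi_mono.
  - intros AB x Ax. apply retB, (psi_mono _ _ AB), retA, Ax.
Qed.

Theorem mainTheorem7 (Q : RQF) :
  (forall A, icpf Q A -> cpf_down Q (restr Q A)) /\
  (forall F, cpf_down Q F -> icpf Q (upcl Q F)) /\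
  (forall A, icpf Q A -> seteq (upcl Q (restr Q A)) A) /\
  (forall F, cpf_down Q F -> seteq (restr Q (upcl Q F)) F) /\
  (forall A B, icpf Q A -> icpf Q B ->
     (subset A B <-> subset (restr Q A) (restr Q B))) /\
  (forall F G, cpf_down Q F -> cpf_down Q G ->
     (subset F G <-> subset (upcl Q F) (upcl Q G))).
Proof.
  split; [exact (restr_cpf_down Q) |].
  split; [exact (upcl_icpf Q) |].
  split; [exact (upcl_restr Q) |].
  split; [exact (restr_upcl Q) |].
  split.
  - intros A B HA HB.
    apply subset_iff_of_retraction with (psi := upcl Q);
      [exact (restr_mono Q) | exact (upcl_mono Q) | exact (upcl_restr Q A HA) | exact (upcl_restr Q B HB)].
  - intros F G HF HG.
    apply subset_iff_of_retraction with (psi := restr Q);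
      [exact (upcl_mono Q) | exact (restr_mono Q) | exact (restr_upcl Q F HF) | exact (restr_upcl Q G HG)].
Qed.
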